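(* Let $E$ be a holomorphic vector bundle over $\mathbb{C}$ with a compatible Hermitian metric, and suppose there are constants $\kappa_0>0$ and $\epsilon_0>0$ such that for all $0<\epsilon<\epsilon_0$ and all compactly supported smooth sections $s\in C^\infty_c(E)$, $$\kappa_0\int_{\mathbb{C}}|s|^2e^{-\epsilon|z|}\,dx\,dy\le\int_{\mathbb{C}}|\overline{\partial}s|^2e^{-\epsilon|z|}\,dx\,dy .$$ Then for any $0<\epsilon<\epsilon_0/4$ there exists no non-trivial (i.e. not identically zero) holomorphic section $s\in L^2(E,e^{-4\epsilon|z|})$.
   Context: $\mathbb{C}$ carries the standard flat metric $dx^2+dy^2=|dz|^2$. $E$ has a connection $\nabla$ compatible with its Hermitian metric and its holomorphic structure, and $\overline{\partial}s=(\nabla_{\partial/\partial\overline{z}}s)\otimes d\overline{z}$, where $\partial/\partial\overline z=\frac12(\partial_x+i\partial_y)$; norms are normalized so that $|s\otimes d\overline{z}|=|s|$. A section $s$ is holomorphic if $\overline{\partial}s=0$. For a positive continuous function $\varphi$ on $\mathbb{C}$, $L^2(E,\varphi)$ is the Hilbert space completion of $C^\infty_c(E)$ under the norm $\|s\|_{L^2(E,\varphi)}=\left(\int_{\mathbb{C}}|s|^2\varphi\,dx\,dy\right)^{1/2}$; that is, it consists of the measurable sections $s$ of $E$ with $\|s\|_{L^2(E,\varphi)}<\infty$. *)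

(* Defs.v *)
From mathcomp Require Import all_boot all_order all_algebra.
From mathcomp Require Import all_classical all_reals all_analysis.
From mathcomp Require Import complex.

Set Implicit Arguments.
Unset Strict Implicit.
Unset Printing Implicit Defensive.

Import Order.TTheory GRing.Theory Num.Theory.
Import numFieldNormedType.Exports.

Local Open Scope classical_set_scope.
Local Open Scope complex_scope.
Local Open Scope ring_scope.

(* The base C is handled through its real coordinates z = (x, y), x + iy being
   the complex number; scalars and components of sections live in R[i].  The
   topology of R * R is the product one, and its library norm is the sup norm,
   which is why the modulus |z| is defined separately below. *)
Definition dir_x {R : realType} : (R * R)%type := (1, 0).
Definition dir_y {R : realType} : (R * R)%type := (0, 1).

Definition modulus {R : realType} (z : R * R) : R :=
  Num.sqrt (z.1 ^+ 2 + z.2 ^+ 2).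

(* C^k on U; only used for U open, where 'D_v f z depends only on f near z. *)
Fixpoint Ck_on (R : realType) (k : nat) (U : set (R * R)) (f : R * R -> R) :
    Prop :=
  (forall z, U z -> {for z, continuous f}) /\
  if k is k'.+1 then
    [/\ forall z, U z -> derivable f z dir_x /\ derivable f z dir_y,
        Ck_on k' U (fun z => 'D_dir_x f z) &
        Ck_on k' U (fun z => 'D_dir_y f z)]
  else True.

Definition smooth_on (R : realType) (U : set (R * R)) (f : R * R -> R[i]) :
    Prop :=
  forall k, Ck_on k U (fun z => complex.Re (f z)) /\ Ck_on k U (fun z => complex.Im (f z)).

Definition cderive (R : realType) (v : R * R) (f : R * R -> R[i]) (z : R * R) :
    R[i] :=
  'D_v (fun w => complex.Re (f w)) z +i* 'D_v (fun w => complex.Im (f w)) z.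

Definition d_zbar (R : realType) (f : R * R -> R[i]) (z : R * R) : R[i] :=
  2^-1 * (cderive dir_x f z + 'i%C * cderive dir_y f z).

Definition holomorphic_on (R : realType) (U : set (R * R))
    (f : R * R -> R[i]) : Prop :=
  smooth_on U f /\ forall z, U z -> d_zbar f z = 0.

(* A holomorphic vector bundle of rank r over C, given by its fibres and an
   atlas of local trivializations with holomorphic transition matrices.
   [triv] and [frame] are meaningful only over [dom i]; the k-th column of the
   transition matrix from chart i to chart j at z is
   [triv j z (frame i z (delta_mx k 0))]. *)
Record holomorphic_bundle (R : realType) (r : nat) := HolomorphicBundle {
  fiber :> R * R -> lmodType R[i];
  chart : Type;
  dom : chart -> set (R * R);
  dom_open : forall i, open (dom i);
  dom_cover : forall z, exists i, dom i z;
  triv : forall (i : chart) (z : R * R), {linear fiber z -> 'cV[R[i]]_r};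
  frame : forall (i : chart) (z : R * R), 'cV[R[i]]_r -> fiber z;
  trivK : forall i z, dom i z -> cancel (triv i z) (frame i z);
  frameK : forall i z, dom i z -> cancel (frame i z) (triv i z);
  transition_holomorphic : forall i j (k l : 'I_r),
    holomorphic_on (dom i `&` dom j)
      (fun z => triv j z (frame i z (delta_mx k 0)) l 0)
}.

Definition section (R : realType) (r : nat) (E : holomorphic_bundle R r) : Type :=
  forall z : R * R, E z.

Definition component (R : realType) (r : nat) (E : holomorphic_bundle R r)
    (s : section E) (i : chart E) (l : 'I_r) (z : R * R) : R[i] :=
  triv i z (s z) l 0.

Definition smooth_section (R : realType) (r : nat) (E : holomorphic_bundle R r)
    (s : section E) : Prop :=
  forall (i : chart E) (l : 'I_r), smooth_on (dom i) (component s i l).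

Definition measurable_section (R : realType) (r : nat)
    (E : holomorphic_bundle R r) (s : section E) : Prop :=
  forall (i : chart E) (l : 'I_r),
    measurable_fun (dom i) (fun z => complex.Re (component s i l z)) /\
    measurable_fun (dom i) (fun z => complex.Im (component s i l z)).

Definition compactly_supported (R : realType) (r : nat)
    (E : holomorphic_bundle R r) (s : section E) : Prop :=
  compact (closure [set z | s z <> 0]).

(* Positivity is in the partial order of R[i]: 0 < c means c is real and
   positive. *)
Record hermitian_metric (R : realType) (r : nat) (E : holomorphic_bundle R r) :=
    HermitianMetric {
  herm :> forall z : R * R, E z -> E z -> R[i];
  herm_linear : forall z (a : R[i]) (u v w : E z),
    herm (a *: u + v) w = a * herm u w + herm v w;
  herm_conj : forall z (u v : E z), herm u v = ((herm v u)^*)%C;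
  herm_posdef : forall z (u : E z), u <> 0 -> 0 < herm u u;
  herm_smooth : forall (i : chart E) (a b : 'cV[R[i]]_r),
    smooth_on (dom i) (fun z => herm (frame i z a) (frame i z b))
}.

Definition sqnorm (R : realType) (r : nat) (E : holomorphic_bundle R r)
    (h : hermitian_metric E) (s : section E) (z : R * R) : R :=
  complex.Re (h z (s z) (s z)).

(* [nabla v s z] is the covariant derivative of s at z along the real tangent
   vector v; [nabla_zbar] is its complex-linear extension evaluated on
   d/dzbar = (d/dx + i d/dy) / 2. *)
Definition nabla_zbar (R : realType) (r : nat) (E : holomorphic_bundle R r)
    (nabla : R * R -> section E -> section E) (s : section E) : section E :=
  fun z => (2^-1 : R[i]) *: (nabla dir_x s z + 'i%C *: nabla dir_y s z).

(* A connection compatible with the metric h and with the holomorphic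
   structure of E; nothing is required of its values on non-smooth sections. *)
Record compatible_connection (R : realType) (r : nat)
    (E : holomorphic_bundle R r) (h : hermitian_metric E) :=
    CompatibleConnection {
  nabla :> R * R -> section E -> section E;
  nabla_smooth : forall v s, smooth_section s -> smooth_section (nabla v s);
  nabla_tangent : forall (a : R) v w s z, smooth_section s ->
    nabla (a *: v + w) s z = a%:C *: nabla v s z + nabla w s z;
  nabla_add : forall v s t z, smooth_section s -> smooth_section t ->
    nabla v (fun w => s w + t w) z = nabla v s z + nabla v t z;
  nabla_leibniz : forall v (f : R * R -> R[i]) s z,
    smooth_on setT f -> smooth_section s ->
    nabla v (fun w => f w *: s w) z = cderive v f z *: s z + f z *: nabla v s z;
  nabla_metric : forall v s t z, smooth_section s -> smooth_section t ->
    cderive v (fun w => h w (s w) (t w)) z =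
    h z (nabla v s z) (t z) + h z (s z) (nabla v t z);
  nabla_holomorphic : forall s (i : chart E) (l : 'I_r) z,
    smooth_section s -> dom i z ->
    component (nabla_zbar nabla s) i l z = d_zbar (component s i l) z
}.

(* The coefficient of the E-valued (0,1)-form dbar s = (nabla_zbar s) (x) dzbar,
   which has the same pointwise norm since |s (x) dzbar| = |s|. *)
Definition dbar (R : realType) (r : nat) (E : holomorphic_bundle R r)
    (h : hermitian_metric E) (D : compatible_connection h) (s : section E) :
    section E :=
  nabla_zbar D s.

Definition holomorphic_section (R : realType) (r : nat)
    (E : holomorphic_bundle R r) (h : hermitian_metric E)
    (D : compatible_connection h) (s : section E) : Prop :=
  smooth_section s /\ forall z, dbar D s z = 0.

Definition weighted_integral (R : realType) (r : nat)
    (E : holomorphic_bundle R r) (h : hermitian_metric E) (s : section E)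
    (phi : R * R -> R) : \bar R :=
  (\int[lebesgue_measure \x lebesgue_measure]_z (sqnorm h s z * phi z)%:E)%E.

Definition L2norm (R : realType) (r : nat) (E : holomorphic_bundle R r)
    (h : hermitian_metric E) (phi : R * R -> R) (s : section E) : \bar R :=
  sqrte (weighted_integral h s phi).

Definition in_L2 (R : realType) (r : nat) (E : holomorphic_bundle R r)
    (h : hermitian_metric E) (phi : R * R -> R) (s : section E) : Prop :=
  measurable_section s /\ (L2norm h phi s < +oo)%E.

(* Main.v *)
Require Import Defs.
From mathcomp Require Import all_boot all_order all_algebra.
From mathcomp Require Import all_classical all_reals all_analysis.
From mathcomp Require Import measurable_realfun complex ring lra.

(** A holomorphic section s that is square integrable against the weight
    phi = exp (- 4 eps |z|) can be approximated by its cutoffs chi_e s, where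
    chi_e z = chi (e z) for a fixed smooth bump chi.  Since 4 eps < eps0, the
    hypothesis applies to chi_e s with the weight phi itself, and the Leibniz
    rule together with dbar s = 0 leaves only the derivative of the cutoff:
    [kappa0 * int |chi_e s|^2 phi <= int |dbar chi_e|^2 |s|^2 phi].
    The gradient of chi_e is of order e, so the right-hand side is at most
    [8 e^2 int |s|^2 phi] ([weighted_integral_dbar_cutoff_le]), which tends to
    0 with e because the integral is finite.  If s z0 <> 0, continuity makes
    the density |s|^2 phi at least some c > 0 on a box around z0, and chi_e is
    at least exp (- 8) on that box once e is small, so the left-hand side stays
    above a positive constant ([weighted_integral_cutoff_ge]).  These two
    bounds are incompatible for small e.

    Two ingredients have to be built. One is the bump: it is a product of
    rescaled and translated copies of the flat function exp (- 1/t), whose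
    derivatives are linear combinations of the functions t^-k exp (- 1/t), so
    that its smoothness is an induction inside this family ([is_derive_flat],
    [Ck_flat_affine]). The other is regularity of |s|^2: it is continuous
    because in a local frame it is a finite sum of products of smooth
    functions ([sqnorm_continuous]), and continuous functions on the plane are
    measurable for the product sigma-algebra because rational boxes form a
    countable basis ([open_measurable_plane]). *)

Set Implicit Arguments.
Unset Strict Implicit.
Unset Printing Implicit Defensive.

Import Order.TTheory GRing.Theory Num.Theory.
Import numFieldNormedType.Exports.

Local Open Scope classical_set_scope.
Local Open Scope ring_scope.

(** * Functions of class C^k on an open set *)

Section CkFunctions.
Context {R : realType}.
Implicit Types (U V : set (R * R)) (f g : R * R -> R).

(** The partial derivatives at a point of U see f only near that point, which is
    inside U by openness; hence equality is needed on U alone.  The algebraic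
    rules below rely on this, as the sum and product rules for derivatives hold
    only at points where both factors are derivable. *)
Lemma Ck_on_ext k U f g : open U -> (forall z, U z -> f z = g z) ->
  Ck_on k U f -> Ck_on k U g.
Proof.
move=> oU; elim: k f g => [|k IH] f g fg /= [cf df].
all: have nfg z : U z -> {near z, f =1 g}.
1,3: by move=> Uz; near=> w; apply: fg; near: w; exact: open_nbhs_nbhs.
all: have cg z : U z -> {for z, continuous g}.
1,3: move=> Uz; have := cf z Uz; rewrite /prop_for /continuous_at -(fg z Uz).
1,2: by apply: cvg_trans; apply: near_eq_cvg; exact: nfg.
  by [].
split=> //; case: df => df dfx dfy; split.
- move=> z Uz; have [fx fy] := df z Uz.
  by split; [move: fx|move: fy]; apply: near_eq_derivable; exact: nfg.
- apply: IH dfx => z Uz; apply: near_eq_derive; exact: nfg.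
- apply: IH dfy => z Uz; apply: near_eq_derive; exact: nfg.
Unshelve. all: by end_near. Qed.

Lemma Ck_onW k U f : Ck_on k.+1 U f -> Ck_on k U f.
Proof.
elim: k f => [|k IH] f [cf df]; first by split.
case: df => df dfx dfy; split; first exact: cf.
by split; [exact: df|exact: IH dfx|exact: IH dfy].
Qed.

Lemma Ck_onS k U V f : U `<=` V -> Ck_on k V f -> Ck_on k U f.
Proof.
move=> UV; elim: k f => [|k IH] f [cf df].
  by split=> // z /UV; exact: cf.
have [{}df dfx dfy] := df; split; first by move=> z /UV; exact: cf.
by split; [move=> z /UV; exact: df|exact: IH|exact: IH].
Qed.

Lemma Ck_on_cst k U (c : R) : Ck_on k U (cst c).
Proof.
elim: k c => [|k IH] c; first by split=> // z _; exact: cvg_cst.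
split; first by move=> z _; exact: cvg_cst.
split; first by move=> z _; split; exact: derivable_cst.
all: rewrite (_ : (fun z => _) = cst 0); first exact: IH.
all: by apply/funext => z; exact: derive_cst.
Qed.

Lemma Ck_onD k U f g : open U -> Ck_on k U f -> Ck_on k U g ->
  Ck_on k U (fun z => f z + g z).
Proof.
move=> oU; elim: k f g => [|k IH] f g [cf df] [cg dg].
all: have cfg z : U z -> {for z, continuous (fun z => f z + g z)}.
1,3: by move=> Uz; apply: cvgD; [exact: cf|exact: cg].
  by split.
have [{}df dfx dfy] := df; have [{}dg dgx dgy] := dg.
split; [exact: cfg|split].
- move=> z Uz; have [fx fy] := df z Uz; have [gx gy] := dg z Uz.
  by split; [exact: derivableD fx gx|exact: derivableD fy gy].
- apply: Ck_on_ext (IH _ _ dfx dgx) => // z Uz.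
  by have [fx _] := df z Uz; have [gx _] := dg z Uz; rewrite -deriveD.
- apply: Ck_on_ext (IH _ _ dfy dgy) => // z Uz.
  by have [_ fy] := df z Uz; have [_ gy] := dg z Uz; rewrite -deriveD.
Qed.

Lemma Ck_onM k U f g : open U -> Ck_on k U f -> Ck_on k U g ->
  Ck_on k U (fun z => f z * g z).
Proof.
move=> oU; elim: k f g => [|k IH] f g Cf Cg.
all: have cfg z : U z -> {for z, continuous (fun z => f z * g z)}.
1,3: by have [cf _] := Cf; have [cg _] := Cg => Uz;
  apply: cvgM; [exact: cf|exact: cg].
  by split.
have Cf' := Ck_onW Cf; have Cg' := Ck_onW Cg.
have [_ [df dfx dfy]] := Cf; have [_ [dg dgx dgy]] := Cg.
split; [exact: cfg|split].
- move=> z Uz; have [fx fy] := df z Uz; have [gx gy] := dg z Uz.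
  by split; [exact: derivableM fx gx|exact: derivableM fy gy].
- apply: Ck_on_ext (Ck_onD oU (IH _ _ Cf' dgx) (IH _ _ Cg' dfx)) => // z Uz.
  have [fx _] := df z Uz; have [gx _] := dg z Uz.
  exact: (esym (deriveM fx gx)).
- apply: Ck_on_ext (Ck_onD oU (IH _ _ Cf' dgy) (IH _ _ Cg' dfy)) => // z Uz.
  have [_ fy] := df z Uz; have [_ gy] := dg z Uz.
  exact: (esym (deriveM fy gy)).
Qed.

End CkFunctions.

(** * The flat function exp (- 1/t) and its derivatives *)

Section Flat.
Context {R : realType}.

(** For k = 0 this is the classical smooth function that is flat at 0; the
    exponent k is there because differentiation stays in the span of the
    family. *)
Definition flat (k : nat) (t : R) : R :=
  if 0 < t then t^-1 ^+ k * expR (- t^-1) else 0.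

Lemma flat_ge0 k t : 0 <= flat k t.
Proof.
by rewrite /flat; case: ifP => // t0; rewrite mulr_ge0 ?expR_ge0// exprn_ge0//
  invr_ge0 ltW.
Qed.

(** With u = 1/t this is u^k <= k! exp u, one term of the exponential series. *)
Lemma flat_le k t : flat k t <= k`!%:R.
Proof.
rewrite /flat; case: ifP => [t0|_]; last exact: ler0n.
have u0 : 0 <= t^-1 by rewrite invr_ge0 ltW.
have k0 : 0 < k`!%:R :> R by rewrite ltr0n fact_gt0.
rewrite expRN ler_pdivrMr ?expR_gt0// mulrC -ler_pdivrMr//.
case: k k0 => [|k] k0.
  by rewrite expr0 fact0 divr1 -expR0 ler_expR.
by rewrite (le_trans _ (expR_ge1Dxn k u0))// lerDr.
Qed.

(** For t > 0 this is the product rule.  The delicate point is t = 0, where the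
    difference quotient tends to 0 because flat k vanishes to second order: it
    is h^2 times the bounded function flat k.+2. *)
Lemma is_derive_flat k (t : R) :
  is_derive t 1 (flat k) (flat k.+2 t - k%:R * flat k.+1 t).
Proof.
have [t0|t0|->] := ltrgtP t 0.
- have -> : flat k.+2 t - k%:R * flat k.+1 t = 0.
    by rewrite /flat ltNge (ltW t0)/= mulr0 subr0.
  apply: near_eq_is_derive (is_derive_cst 0 t 1).
  near=> x; rewrite /flat /cst ltNge (_ : x <= 0)//.
  by near: x; exact: lt_le_nbhsl.
- have tn0 : t != 0 by rewrite gt_eqF.
  have dV : is_derive t 1 (fun x : R => x^-1) (- t ^- 2).
    by have := is_deriveV tn0 (is_derive_id t 1); rewrite scaler1.
  have dX : is_derive t 1 (fun x : R => x^-1 ^+ k)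
      ((k%:R * t^-1 ^+ k.-1) * (- t ^- 2)).
    by have := is_deriveX k dV; rewrite exprfctE.
  have dN : is_derive t 1 (fun x : R => - x^-1) (t ^- 2).
    by have := is_deriveN dV; rewrite opprK.
  have dE : is_derive t 1 (fun x : R => expR (- x^-1))
      (expR (- t^-1) * t ^- 2).
    exact: (@is_derive1_comp _ expR (fun x : R => - x^-1)).
  have -> : flat k.+2 t - k%:R * flat k.+1 t =
      t^-1 ^+ k *: (expR (- t^-1) * t ^- 2) +
      expR (- t^-1) *: (k%:R * t^-1 ^+ k.-1 * - t ^- 2).
    rewrite /flat t0 /GRing.scale/= -exprVn; case: k {dX} => [|k].
      by rewrite /= !mul0r mulr0 addr0 subr0 expr0 mul1r mulrC.
    by rewrite /= !exprS; ring.
  apply: near_eq_is_derive (is_deriveM dX dE).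
  near=> x; rewrite /flat (_ : 0 < x)//.
  by near: x; exact: lt_nbhsr.
- have -> : flat k.+2 0 - k%:R * flat k.+1 (0 : R) = 0.
    by rewrite /flat ltxx mulr0 subr0.
  suff H : (fun h : R => h^-1 *: (flat k (h *: 1 + 0) - flat k 0))
      @ 0^' --> (0 : R).
    by apply: DeriveDef; [apply/cvg_ex; exists 0|exact: cvg_lim].
  have -> : (fun h : R => h^-1 *: (flat k (h *: 1 + 0) - flat k 0)) =
      (fun h => h * flat k.+2 h).
    apply/funext => h; rewrite addr0 /flat ltxx subr0 /GRing.scale/= mulr1.
    case: ifPn => h0; last by rewrite !mulr0.
    by rewrite !exprS; field; rewrite gt_eqF.
  apply/cvgrPdist_le => e e0; near=> h.
  rewrite sub0r normrN normrM (ger0_norm (flat_ge0 _ _)).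
  apply: (@le_trans _ _ (`|h| * (k.+2)`!%:R)).
    by rewrite ler_wpM2l// flat_le.
  rewrite -ler_pdivlMr ?ltr0n ?fact_gt0//.
  near: h; apply: dnbhs0_le; rewrite divr_gt0// ltr0n fact_gt0//.
Unshelve. all: by end_near. Qed.

(** The difference quotients of f composed with an affine form, in direction v,
    are literally those of f in the direction of the linear part applied
    to v. *)
Lemma is_derive_affine (f : R -> R) (a b c d : R) (z v : R * R) :
  is_derive (c + (a * z.1 + b * z.2)) 1 f d ->
  is_derive z v (fun w => f (c + (a * w.1 + b * w.2)))
    ((a * v.1 + b * v.2) * d).
Proof.
set l := fun w : R * R => c + (a * w.1 + b * w.2); move=> fd.
pose m : R := a * v.1 + b * v.2.
have E : (fun h : R => h^-1 *: (((f \o l) \o shift z) (h *: v) - (f \o l) z)) =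
    (fun h : R => h^-1 *: ((f \o shift (l z)) (h *: m) - f (l z))).
  apply/funext => h /=; congr (_ *: (f _ - _)).
  rewrite /l /m /= -![_ *: _]/(_ * _); ring.
have df : differentiable f (l z) by apply/derivable1_diffP.
have -> : (a * v.1 + b * v.2) * d = 'D_m f (l z).
  have <- : 'D_1 f (l z) = d by exact: derive_val.
  by rewrite !deriveE// -/m -[m in RHS]mulr1 -[m * 1]/(m *: 1) linearZ.
apply: DeriveDef; last by rewrite /derive E.
by rewrite /derivable E; exact: diff_derivable.
Qed.

(** Induction on k for all exponents j at once: a derivative of flat j involves
    the exponents j+1 and j+2. *)
Lemma Ck_flat_affine k j (a b c : R) :
  Ck_on k setT (fun z => flat j (c + (a * z.1 + b * z.2))).
Proof.
have D i z v : is_derive z v (fun z => flat i (c + (a * z.1 + b * z.2))) _ :=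
  is_derive_affine v (is_derive_flat i _).
have C i z : {for z, continuous (fun z => flat i (c + (a * z.1 + b * z.2)))}.
  apply: (@continuous_comp _ _ _ (fun z : R * R => c + (a * z.1 + b * z.2))).
    apply: cvgD; first exact: cvg_cst.
    by apply: cvgD; apply: cvgM;
      [exact: cvg_cst|exact: cvg_fst|exact: cvg_cst|exact: cvg_snd].
  apply: differentiable_continuous; apply/derivable1_diffP.
  by have := is_derive_flat i (c + (a * z.1 + b * z.2)); case.
elim: k j => [|k IH] j; first by split=> // z _; exact: C.
split; first by move=> z _; exact: C.
have Dv v : Ck_on k setT
    (fun z => 'D_v (fun z => flat j (c + (a * z.1 + b * z.2))) z).
  pose m := a * v.1 + b * v.2.
  have Cm : Ck_on k setT (fun z => m * (flat j.+2 (c + (a * z.1 + b * z.2)) +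
      (- j%:R) * flat j.+1 (c + (a * z.1 + b * z.2)))).
    apply: Ck_onM openT (Ck_on_cst _ _ _) _; apply: Ck_onD openT (IH _) _.
    exact: Ck_onM openT (Ck_on_cst _ _ _) (IH _).
  apply: Ck_on_ext openT _ Cm => z _.
  by have [_ ->] := D j z v; rewrite mulNr.
split; [|exact: Dv|exact: Dv].
by move=> z _; split; [have [] := D j z dir_x|have [] := D j z dir_y].
Qed.

End Flat.

(** * Smooth cutoffs at scale 1/e *)

Section Cutoff.
Context {R : realType}.
Implicit Types (e t : R) (z : R * R).

Definition bump e t : R := flat 0 (1 + e * t) * flat 0 (1 - e * t).

(** A product of one-variable bumps is used rather than a radial function: it
    avoids the square root in the modulus and is supported in the square of
    half-width 1/e. *)
Definition cutoff e z : R := bump e z.1 * bump e z.2.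

Lemma flat0_le1 t : flat 0 t <= 1.
Proof. exact: flat_le. Qed.

Lemma flat0_ge_half t : 2^-1 <= t -> expR (- 2) <= flat 0 t.
Proof.
move=> t2; have t0 : 0 < t by apply: lt_le_trans t2; rewrite invr_gt0.
rewrite /flat t0 expr0 mul1r ler_expR lerN2 -[leRHS]invrK lef_pV2 ?posrE//.
Qed.

Lemma bump_ge0 e t : 0 <= bump e t.
Proof. by rewrite mulr_ge0 ?flat_ge0. Qed.

Lemma bump_le1 e t : bump e t <= 1.
Proof. by rewrite mulr_ile1 ?flat_ge0 ?flat0_le1. Qed.

Lemma bump_support e t : 0 < e -> bump e t != 0 -> `|t| <= e^-1.
Proof.
move=> e0; apply: contraNT; rewrite -ltNge => te.
have {te} : 1 < e * `|t| by rewrite mulrC -ltr_pdivrMr// div1r.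
rewrite /bump /flat; case: (ger0P t) => t0 et.
  by rewrite [X in _ * (if X then _ else _)]ltNge subr_le0 ltW// mulr0.
rewrite [X in (if X then _ else _) * _]ltNge (_ : 1 + e * t <= 0) ?mul0r//.
by rewrite -[e * t]opprK subr_le0 -mulrN ltW.
Qed.

Lemma bump_ge e t : `|e * t| <= 2^-1 -> expR (- 4) <= bump e t.
Proof.
rewrite ler_norml => /andP[et1 et2].
have -> : - 4 = - 2 + - 2 :> R by ring.
rewrite expRD ler_pM ?expR_ge0// flat0_ge_half//; lra.
Qed.

Lemma is_derive_bump e t : is_derive t 1 (bump e)
  (e * (flat 2 (1 + e * t) * flat 0 (1 - e * t) -
        flat 0 (1 + e * t) * flat 2 (1 - e * t))).
Proof.
have D (a : R) : is_derive t 1 (fun t => flat 0 (1 + a * t))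
    (flat 2 (1 + a * t) * a).
  have Da : is_derive t 1 (fun t => 1 + a * t) a.
    have := is_deriveD (is_derive_cst (1 : R) t 1)
      (is_deriveZ a (is_derive_id t (1 : R))).
    by rewrite add0r [a *: 1]mulr1.
  have := @is_derive1_comp _ _ (fun t => 1 + a * t) t _ _
    (is_derive_flat 0 (1 + a * t)) Da.
  by rewrite mul0r subr0.
have -> : bump e =
    (fun t => flat 0 (1 + e * t)) * (fun t => flat 0 (1 + - e * t)).
  by apply/funext => x; rewrite /bump -mulNr.
have -> : e * (flat 2 (1 + e * t) * flat 0 (1 - e * t) -
    flat 0 (1 + e * t) * flat 2 (1 - e * t)) =
    flat 0 (1 + e * t) *: (flat 2 (1 + - e * t) * - e) +
    flat 0 (1 + - e * t) *: (flat 2 (1 + e * t) * e).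
  by rewrite -![_ *: _]/(_ * _) mulNr; ring.
exact: is_deriveM (D e) (D (- e)).
Qed.

(** The chain rule through 1 + e t and 1 - e t gives a factor e, and the flat
    functions that remain are bounded: flat 0 by 1 and flat 2 by 2. *)
Lemma norm_derive_bump e t : 0 <= e -> `|'D_1 (bump e) t| <= 4 * e.
Proof.
move=> e0; rewrite (derive_val (is_derive:=is_derive_bump e t)).
rewrite normrM (ger0_norm e0) mulrC ler_wpM2r//.
have := flat_ge0 0 (1 + e * t); have := flat_ge0 0 (1 - e * t).
have := flat0_le1 (1 + e * t); have := flat0_le1 (1 - e * t).
have := flat_ge0 2 (1 + e * t); have := flat_ge0 2 (1 - e * t).
have := flat_le 2 (1 + e * t); have := flat_le 2 (1 - e * t).
rewrite (_ : 2`!%:R = 2 :> R)// ler_norml => *; apply/andP; split; nra.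
Qed.

Lemma is_derive_cutoff e z v : is_derive z v (cutoff e)
  (v.1 * 'D_1 (bump e) z.1 * bump e z.2 +
   bump e z.1 * (v.2 * 'D_1 (bump e) z.2)).
Proof.
have Db t : is_derive t 1 (bump e) ('D_1 (bump e) t).
  by apply: DeriveDef => //; have [] := is_derive_bump e t.
have D1 : is_derive z v (fun z => bump e z.1) (v.1 * 'D_1 (bump e) z.1).
  have E (w : R * R) : w.1 = 0 + (1 * w.1 + 0 * w.2).
    by rewrite mul1r mul0r addr0 add0r.
  have := @is_derive_affine _ (bump e) 1 0 0 ('D_1 (bump e) z.1) z v.
  by under eq_fun do rewrite -E; rewrite -E mul1r mul0r addr0; apply.
have D2 : is_derive z v (fun z => bump e z.2) (v.2 * 'D_1 (bump e) z.2).
  have E (w : R * R) : w.2 = 0 + (0 * w.1 + 1 * w.2).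
    by rewrite mul1r mul0r !add0r.
  have := @is_derive_affine _ (bump e) 0 1 0 ('D_1 (bump e) z.2) z v.
  by under eq_fun do rewrite -E; rewrite -E mul1r mul0r add0r; apply.
have := is_deriveM D1 D2.
by rewrite -![_ *: _]/(_ * _) addrC [bump e z.2 * _]mulrC.
Qed.

Lemma Ck_cutoff e k : Ck_on k setT (cutoff e).
Proof.
have oT := @openT (R * R)%type.
have H := Ck_onM oT
 (Ck_onM oT (@Ck_flat_affine R k 0 e 0 1) (@Ck_flat_affine R k 0 (- e) 0 1))
 (Ck_onM oT (@Ck_flat_affine R k 0 0 e 1) (@Ck_flat_affine R k 0 0 (- e) 1)).
apply: Ck_on_ext oT _ H => z _.
by rewrite /cutoff /bump !mul0r !add0r !addr0 !mulNr.
Qed.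

Lemma norm_derive_cutoff e z : 0 <= e ->
  `|'D_dir_x (cutoff e) z| <= 4 * e /\ `|'D_dir_y (cutoff e) z| <= 4 * e.
Proof.
move=> e0; split; rewrite (derive_val (is_derive:=is_derive_cutoff e z _))/=.
- rewrite mul1r mul0r mulr0 addr0 normrM (ger0_norm (bump_ge0 _ _)).
  rewrite -[leRHS]mulr1.
  by rewrite ler_pM ?bump_ge0 ?bump_le1 ?norm_derive_bump.
- rewrite mul0r !mul1r mul0r add0r normrM (ger0_norm (bump_ge0 _ _)).
  rewrite -[leRHS]mul1r.
  by rewrite ler_pM ?bump_ge0 ?bump_le1 ?norm_derive_bump.
Qed.

Lemma cutoff_ge e z : `|e * z.1| <= 2^-1 -> `|e * z.2| <= 2^-1 ->
  expR (- 8) <= cutoff e z.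
Proof.
move=> e1 e2; have -> : - 8 = - 4 + - 4 :> R by ring.
by rewrite expRD ler_pM ?expR_ge0// bump_ge.
Qed.

End Cutoff.

(** * Regularity of the pointwise norm of a section *)

Section Hermitian.
Local Open Scope complex_scope.
Context {R : realType} {r : nat} {E : holomorphic_bundle R r}.
Context (h : hermitian_metric E).
Implicit Types (z : R * R) (s : section E).

Lemma hermD z (u v w : E z) : h z (u + v) w = h z u w + h z v w.
Proof. by have := herm_linear h 1 u v w; rewrite scale1r mul1r. Qed.

Lemma herm0 z (w : E z) : h z 0 w = 0.
Proof. by apply: (addrI (h z 0 w)); rewrite -hermD !addr0. Qed.

Lemma hermZ z a (u w : E z) : h z (a *: u) w = a * h z u w.
Proof. by have := herm_linear h a u 0 w; rewrite herm0 !addr0. Qed.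

Lemma herm_suml z (I : finType) (c : I -> R[i]) (u : I -> E z) (w : E z) :
  h z (\sum_k c k *: u k) w = \sum_k c k * h z (u k) w.
Proof.
rewrite (big_morph (fun v => h z v w) (fun x y => hermD x y w) (herm0 w)).
by apply: eq_bigr => k _; rewrite hermZ.
Qed.

Lemma herm_sumr z (I : finType) (c : I -> R[i]) (u : I -> E z) (w : E z) :
  h z w (\sum_k c k *: u k) = \sum_k (c k)^* * h z w (u k).
Proof.
rewrite herm_conj herm_suml rmorph_sum; apply: eq_bigr => k _.
by rewrite rmorphM/= [h z w _]herm_conj.
Qed.

Lemma sqnormZ (a : R * R -> R[i]) s z :
  sqnorm h (fun w => a w *: s w) z =
    (complex.Re (a z) ^+ 2 + complex.Im (a z) ^+ 2) * sqnorm h s z.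
Proof.
rewrite /sqnorm hermZ herm_conj hermZ rmorphM/= -herm_conj mulrA.
by case: (a z) => x y; case: (h z _ _) => p q /=; ring.
Qed.

Lemma sqnorm_gt0 s z : s z <> 0 -> 0 < sqnorm h s z.
Proof. by move=> /(herm_posdef h); rewrite ltcE => /andP[]. Qed.

Lemma sqnorm_ge0 s z : 0 <= sqnorm h s z.
Proof.
have [sz0|/eqP/sqnorm_gt0/ltW//] := eqVneq (s z) 0.
by rewrite /sqnorm sz0 herm0.
Qed.

(** The frame is linear over the domain of its chart, being inverse to the
    linear trivialization there. *)
Lemma section_frame s i z : dom i z ->
  s z = \sum_l component s i l z *: frame i z (delta_mx l 0).
Proof.
move=> iz; rewrite -[LHS](trivK iz); apply: (can_inj (trivK iz)).
rewrite frameK// linear_sum/=; apply/matrixP => l j; rewrite ord1 {j} summxE.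
rewrite (bigD1 l)//= linearZ/= frameK// !mxE eqxx mulr1 big1 ?addr0//.
by move=> k kl; rewrite linearZ/= frameK// !mxE eq_sym (negPf kl) mulr0.
Qed.

End Hermitian.

Section ComplexContinuity.
Local Open Scope complex_scope.
Context {R : realType}.
Implicit Types (z : R * R) (f g : R * R -> R[i]).

(** Continuity is stated through real and imaginary parts, the form in which
    smoothness of complex functions is given. *)
Definition ccontinuous_at z f :=
  {for z, continuous (fun w => complex.Re (f w))} /\
  {for z, continuous (fun w => complex.Im (f w))}.

Lemma ccontinuous_atM z f g :
  ccontinuous_at z f -> ccontinuous_at z g ->
  ccontinuous_at z (fun w => f w * g w).
Proof.
move=> [f1 f2] [g1 g2]; split.
- rewrite (_ : (fun w => _) = (fun w => complex.Re (f w) * complex.Re (g w) -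
      complex.Im (f w) * complex.Im (g w))).
    by apply: cvgB; apply: cvgM.
  by apply/funext => w; case: (f w) (g w) => a b [c d].
- rewrite (_ : (fun w => _) = (fun w => complex.Re (f w) * complex.Im (g w) +
      complex.Im (f w) * complex.Re (g w))).
    by apply: cvgD; apply: cvgM.
  by apply/funext => w; case: (f w) (g w) => a b [c d].
Qed.

Lemma ccontinuous_at_conj z f :
  ccontinuous_at z f -> ccontinuous_at z (fun w => (f w)^*).
Proof.
move=> [f1 f2]; split.
- by rewrite (_ : (fun w => _) = (fun w => complex.Re (f w)))//;
    apply/funext => w; case: (f w).
- rewrite (_ : (fun w => _) = (fun w => - complex.Im (f w))).
    exact: cvgN.
  by apply/funext => w; case: (f w).
Qed.

Lemma ccontinuous_at_sum z (I : Type) (t : seq I) (F : I -> R * R -> R[i]) :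
  (forall k, ccontinuous_at z (F k)) ->
  ccontinuous_at z (fun w => \sum_(k <- t) F k w).
Proof.
move=> cF; elim: t => [|k t [IH1 IH2]].
  by under eq_fun do rewrite big_nil; split; exact: cvg_cst.
under eq_fun do rewrite big_cons; have [F1 F2] := cF k; split.
- rewrite (_ : (fun w => _) = (fun w => complex.Re (F k w) +
      complex.Re (\sum_(j <- t) F j w))); first exact: cvgD.
  by apply/funext => w; case: (F k w) (\sum_(j <- t) F j w) => a b [].
- rewrite (_ : (fun w => _) = (fun w => complex.Im (F k w) +
      complex.Im (\sum_(j <- t) F j w))); first exact: cvgD.
  by apply/funext => w; case: (F k w) (\sum_(j <- t) F j w) => a b [].
Qed.

Lemma smooth_on_ccontinuous U f z : smooth_on U f -> U z -> ccontinuous_at z f.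
Proof. by move=> /(_ 0%N)[[Rf _] [If _]] Uz; split; [exact: Rf|exact: If]. Qed.

End ComplexContinuity.

Local Open Scope complex_scope.

(** In the frame of a chart around z, the squared norm is the finite sum of the
    products c_k conj(c_l) h(e_k, e_l), all of whose factors are smooth. *)
Lemma sqnorm_continuous {R : realType} {r : nat} {E : holomorphic_bundle R r}
  (h : hermitian_metric E) (s : section E) :
  smooth_section s -> continuous (sqnorm h s).
Proof.
move=> ss z; have [i iz] := dom_cover E z.
pose g w := \sum_k (component s i k w * \sum_l ((component s i l w)^* *
  h w (frame i w (delta_mx k 0)) (frame i w (delta_mx l 0)))).
have [Rg _] : ccontinuous_at z g.
  apply: ccontinuous_at_sum => k; apply: ccontinuous_atM.
    exact: smooth_on_ccontinuous (ss i k) iz.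
  apply: ccontinuous_at_sum => l; apply: ccontinuous_atM.
    by apply: ccontinuous_at_conj; exact: smooth_on_ccontinuous (ss i l) iz.
  exact: smooth_on_ccontinuous (herm_smooth h _ _ _) iz.
have sg w : dom i w -> complex.Re (g w) = sqnorm h s w.
  move=> iw; rewrite /sqnorm [in h w _](section_frame s iw) herm_suml.
  congr complex.Re; apply: eq_bigr => k _; congr (_ * _).
  by rewrite [in RHS](section_frame s iw) herm_sumr.
rewrite /continuous_at -sg//; apply: cvg_trans Rg; apply: near_eq_cvg.
exact: filterS sg (open_nbhs_nbhs (conj (@dom_open _ _ E i) iz)).
Qed.

(** * Measurability of continuous functions on the plane *)

Section PlaneMeasurability.
Context {R : realType}.

(** An open set is the union of the boxes with rational centre and radius
    1/(n+1) that it contains; there are countably many, and each is a product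
    of two intervals because balls for the sup norm are boxes. *)
Lemma open_measurable_plane (U : set (R * R)) : open U -> measurable U.
Proof.
move=> oU.
pose B (q : rat * rat * nat) :=
  ball (ratr q.1.1 : R, ratr q.1.2 : R) q.2.+1%:R^-1.
pose F q := if `[< B q `<=` U >] then B q else set0.
have -> : U = \bigcup_q F q.
  apply/seteqP; split=> [z Uz|z [q _]]; last first.
    by rewrite /F; case: ifPn => // /asboolP BU /BU.
  have /nbhs_ballP[e /= e0 eU] := open_nbhs_nbhs (conj oU Uz).
  have e20 : 0 < e / 2 by rewrite divr_gt0.
  have [n _ /(_ n (leqnn n))/= ne] := near_infty_natSinv_lt (PosNum e20).
  have n0 : 0 < n.+1%:R^-1 :> R by [].
  have rat_near (x : R) : exists q : rat, ball (ratr q : R) n.+1%:R^-1 x.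
    have xn : x < x + n.+1%:R^-1 by rewrite ltrDl.
    have [q] := rat_in_itvoo xn; rewrite in_itv/= => /andP[xq qx].
    exists q; rewrite /ball/= ger0_norm ?subr_ge0 ?ltW//.
    by rewrite ltrBlDr addrC.
  have [[p Bp] [q Bq]] := (rat_near z.1, rat_near z.2).
  have Bz : B (p, q, n) z by split.
  exists (p, q, n) => //; rewrite /F; case: ifPn => // /asboolP; case=> w Bw.
  apply: eU; apply: (@le_ball _ _ z (n.+1%:R^-1 + n.+1%:R^-1)).
    by rewrite [leRHS](splitr e) lerD ?ltW.
  exact: ball_triangle (ball_sym Bz) Bw.
apply: countable_bigcupT_measurable; first exact: countableP.
move=> q; rewrite /F; case: ifPn => // _.
rewrite (_ : B q = ball (ratr q.1.1 : R) q.2.+1%:R^-1 `*`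
                   ball (ratr q.1.2 : R) q.2.+1%:R^-1)//.
by apply: measurableX; exact: measurable_ball.
Qed.

Lemma continuous_measurable_plane (f : R * R -> R) :
  continuous f -> measurable_fun setT (fun z => (f z)%:E).
Proof.
move=> /continuousP cf; apply/measurable_EFinP.
apply: (measurability _ (RGenOpens.measurableE R)).
move=> _ [_ [a [b ->] <-]]; rewrite setTI; apply: open_measurable_plane.
exact/cf/interval_open.
Qed.

End PlaneMeasurability.

(* Otherwise the quantifiers hidden in measurable_fun count as arguments. *)
Arguments continuous_measurable_plane {R} f _.

(** * Cutting off a holomorphic section *)

Section CutoffSection.
Context {R : realType} {r : nat} {E : holomorphic_bundle R r}.
Context {h : hermitian_metric E} (D : compatible_connection h).
Implicit Types (z : R * R) (s : section E) (chi : R * R -> R).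

Definition scale_section chi s : section E := fun z => (chi z)%:C *: s z.

Lemma smooth_on_real U chi : (forall k, Ck_on k U chi) ->
  smooth_on U (fun z => (chi z)%:C).
Proof. by move=> Cchi k; split=> //; exact: Ck_on_cst. Qed.

Lemma smooth_scale_section chi s : (forall k, Ck_on k setT chi) ->
  smooth_section s -> smooth_section (scale_section chi s).
Proof.
move=> Cchi ss i l k; have [Rs Is] := ss i l k.
have oi := @dom_open _ _ E i.
have Ci : Ck_on k (dom i) chi by apply: Ck_onS (Cchi k).
have cE z : component (scale_section chi s) i l z =
    (chi z)%:C * component s i l z.
  by rewrite /component /scale_section linearZ mxE.
split.
- apply: Ck_on_ext oi _ (Ck_onM oi Ci Rs) => z _; rewrite cE.
  by case: (component s i l z) => a b /=; rewrite mul0r subr0.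
- apply: Ck_on_ext oi _ (Ck_onM oi Ci Is) => z _; rewrite cE.
  by case: (component s i l z) => a b /=; rewrite mul0r addr0.
Qed.

(** Leibniz rule: the term chi * dbar s vanishes, so only the
    derivative of the cutoff, which is small, remains. *)
Lemma dbar_scale_section chi s z : (forall k, Ck_on k setT chi) ->
  holomorphic_section D s ->
  dbar D (scale_section chi s) z = d_zbar (fun w => (chi w)%:C) z *: s z.
Proof.
move=> Cchi [ss hs].
have Lz v := nabla_leibniz D v z (smooth_on_real Cchi) ss.
rewrite /dbar /nabla_zbar /scale_section !{}Lz.
have : dbar D s z = 0 := hs z; rewrite /dbar /nabla_zbar.
set Nx := D dir_x s z; set Ny := D dir_y s z => N0.
rewrite /d_zbar; set cx := cderive _ _ z; set cy := cderive _ _ z.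
rewrite -[RHS]addr0 -[X in _ = _ + X](scaler0 _ ((chi z)%:C)) -N0.
rewrite !scalerDr !scalerA -!addrA mulrDr scalerDl -!addrA; congr (_ + _).
by rewrite addrCA mulrA; congr (_ + (_ *: _ + _ *: _)); ring.
Qed.

Lemma d_zbar_real chi z :
  complex.Re (d_zbar (fun w => (chi w)%:C) z) = 2^-1 * 'D_dir_x chi z /\
  complex.Im (d_zbar (fun w => (chi w)%:C) z) = 2^-1 * 'D_dir_y chi z.
Proof.
have I0 v : 'D_v (fun w => complex.Im ((chi w)%:C)) z = 0 by exact: derive_cst.
have two : 2^-1 = (2^-1 : R)%:C by rewrite fmorphV rmorph_nat.
by rewrite /d_zbar two /cderive !I0 /=; split; ring.
Qed.

Lemma compact_scale_cutoff (e : R) s : 0 < e ->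
  compactly_supported (scale_section (cutoff e) s).
Proof.
move=> e0; pose I := [set t : R | t \in `[- e^-1, e^-1]].
have cI : compact (I `*` I) by apply: compact_setX; exact: segment_compact.
apply: (subclosed_compact _ cI); first exact: closed_closure.
have clI : closed (I `*` I).
  by apply: compact_closed cI; exact: norm_hausdorff.
rewrite [X in _ `<=` X](_ : _ = closure (I `*` I)); last exact/closure_id.
apply: closure_subset => z; rewrite /scale_section /= => cs0.
have : cutoff e z != 0.
  by apply/eqP => c0; apply: cs0; rewrite c0 scale0r.
rewrite mulf_eq0 negb_or => /andP[b1 b2].
by split; rewrite /I/= in_itv/= -ler_norml; exact: bump_support.
Qed.

End CutoffSection.

(** * Weighted integrals of the cutoffs *)

Section CutoffIntegrals.
Context {R : realType} {r : nat} {E : holomorphic_bundle R r}.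
Context {h : hermitian_metric E} (D : compatible_connection h).
Context (s : section E) (phi : R * R -> R) (hs : holomorphic_section D s).
Context (phi_cont : continuous phi) (phi_ge0 : forall z, 0 <= phi z).

Local Notation mu := (lebesgue_measure \x lebesgue_measure)%E.

Let density z := sqnorm h s z * phi z.

Let density_cont : continuous density.
Proof.
by move=> z; apply: cvgM; [exact: sqnorm_continuous hs.1 z|exact: phi_cont].
Qed.

Let density_ge0 z : 0 <= density z.
Proof. by rewrite mulr_ge0 ?sqnorm_ge0. Qed.

Let measurable_density : measurable_fun setT (fun z => (density z)%:E).
Proof. exact: continuous_measurable_plane. Qed.

(** Pointwise, |dbar chi|^2 = (|chi_x|^2 + |chi_y|^2) / 4 and both partial
    derivatives are at most 4 e, whence the factor 8 e^2. *)
Lemma weighted_integral_dbar_cutoff_le (e : R) : 0 <= e ->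
  (weighted_integral h (dbar D (scale_section (cutoff e) s)) phi <=
   (8 * e ^+ 2)%:E * weighted_integral h s phi)%E.
Proof.
move=> e0.
have avg (p q t : R) : p <= 16 * t -> q <= 16 * t -> 4^-1 * (p + q) <= 8 * t.
  by move=> *; lra.
pose g (z : R * R) : R := 4^-1 *
  ('D_dir_x (cutoff e) z ^+ 2 + 'D_dir_y (cutoff e) z ^+ 2).
have sq z : sqnorm h (dbar D (scale_section (cutoff e) s)) z =
    g z * sqnorm h s z.
  have -> : sqnorm h (dbar D (scale_section (cutoff e) s)) z =
      sqnorm h (fun w => d_zbar (fun v => (cutoff e v)%:C) w *: s w) z.
    by rewrite /sqnorm (dbar_scale_section z (Ck_cutoff e) hs).
  rewrite sqnormZ; have [-> ->] := d_zbar_real (cutoff e) z.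
  rewrite /g; move: ('D_dir_x _ z) ('D_dir_y _ z) (sqnorm h s z) => p q t.
  by field.
have [_ [_ [cx _] [cy _]]] := Ck_cutoff e 1.
have cg : continuous g.
  move=> z; apply: cvgM; first exact: cvg_cst.
  by apply: cvgD; [apply: cvgM; exact: cx|apply: cvgM; exact: cy].
have g_le z : g z <= 8 * e ^+ 2.
  have [dx dy] := norm_derive_cutoff z e0.
  have sq4 (x : R) : `|x| <= 4 * e -> x ^+ 2 <= 16 * e ^+ 2.
    move=> xe; rewrite -[x ^+ 2]ger0_norm ?sqr_ge0// normrX.
    have -> : 16 * e ^+ 2 = (4 * e) ^+ 2 by ring.
    by rewrite lerXn2r ?nnegrE ?mulr_ge0.
  exact: avg (sq4 _ dx) (sq4 _ dy).
have g_ge0 z : 0 <= g z by rewrite mulr_ge0 ?invr_ge0 ?addr_ge0 ?sqr_ge0.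
rewrite /weighted_integral -ge0_integralZl//; last 2 first.
- by move=> z _; rewrite lee_fin; exact: density_ge0.
- by rewrite lee_fin mulr_ge0 ?sqr_ge0.
apply: ge0_le_integral => //.
- by move=> z _; rewrite lee_fin sq -mulrA mulr_ge0// density_ge0.
- apply: continuous_measurable_plane => z.
  under eq_fun do rewrite sq -mulrA.
  by apply: cvgM; [exact: cg|exact: density_cont].
- exact: measurable_funeM.
- move=> z _; rewrite -EFinM lee_fin sq -mulrA ler_wpM2r//.
  exact: density_ge0.
Qed.

(** The integral is bounded below by its part over the box of half-width d,
    where the cutoff is at least exp (- 8), hence its square at least
    exp (- 16). *)
Lemma weighted_integral_cutoff_ge (e T c d : R) (z0 : R * R) :
  0 <= e -> e * T <= 2^-1 -> 0 < d -> 0 <= c ->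
  (forall z, ball z0 d z -> `|z.1| <= T /\ `|z.2| <= T) ->
  (forall z, ball z0 d z -> c <= sqnorm h s z * phi z) ->
  ((expR (- 16) * c * (d *+ 2) ^+ 2)%:E <=
   weighted_integral h (scale_section (cutoff e) s) phi)%E.
Proof.
move=> e0 eT d0 c0 BT Bc.
have sq z : sqnorm h (scale_section (cutoff e) s) z =
    cutoff e z ^+ 2 * sqnorm h s z.
  by rewrite sqnormZ /= expr0n addr0.
have [cc _] := Ck_cutoff e 0.
have mB : measurable (ball z0 d).
  by apply: open_measurable_plane; exact: ball_open.
have mF : measurable_fun setT (fun z =>
    (sqnorm h (scale_section (cutoff e) s) z * phi z)%:E).
  apply: continuous_measurable_plane => z.
  under eq_fun do rewrite sq -mulrA.
  by apply: cvgM; [apply: cvgM; exact: cc|exact: density_cont].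
have F0 z : (0 <= (sqnorm h (scale_section (cutoff e) s) z * phi z)%:E)%E.
  by rewrite lee_fin mulr_ge0 ?sqnorm_ge0.
have muB : mu (ball z0 d) = ((d *+ 2) ^+ 2)%:E.
  rewrite (_ : ball z0 d = ball z0.1 d `*` ball z0.2 d)//.
  transitivity
    (lebesgue_measure (ball z0.1 d) * lebesgue_measure (ball z0.2 d))%E.
    by apply: product_measure1E; exact: measurable_ball.
  by rewrite expr2 EFinM; congr (_ * _)%E;
    apply: lebesgue_measure_ball; exact: ltW.
rewrite EFinM -muB -integral_cst// /weighted_integral.
have sub := ge0_subset_integral mu mB measurableT mF
  (fun z _ => F0 z) (@subsetT _ _).
apply: le_trans sub.
apply: ge0_le_integral => //.
- by move=> z _; rewrite lee_fin mulr_ge0 ?expR_ge0.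
- exact: measurable_funTS mF.
- move=> z Bz; rewrite lee_fin sq -mulrA ler_pM ?expR_ge0 ?Bc//.
  have [z1 z2] := BT z Bz.
  have eB (x : R) : `|x| <= T -> `|e * x| <= 2^-1.
    by move=> xT; rewrite normrM (ger0_norm e0) (le_trans _ eT)// ler_wpM2l.
  have -> : - 16 = - 8 + - 8 :> R by ring.
  by rewrite expRD expr2 ler_pM ?expR_ge0// cutoff_ge// eB.
Qed.

End CutoffIntegrals.

Lemma modulus_continuous {R : realType} : continuous (@modulus R).
Proof.
move=> z.
apply: (@continuous_comp _ _ _ (fun z : R * R => z.1 ^+ 2 + z.2 ^+ 2)).
  by apply: cvgD; apply: cvgM; (exact: cvg_fst || exact: cvg_snd).
exact: sqrt_continuous.
Qed.

(** Any e below 1, 1 / (2 T) and m / (8 a) will do; the inverse of a sum of the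
    reciprocals is below all three and also makes sense when T or a is 0. *)
Lemma exists_small_scale {R : realFieldType} (a m T : R) :
  0 <= a -> 0 < m -> 0 <= T ->
  exists e : R, [/\ 0 < e, e * T <= 2^-1 & 8 * e ^+ 2 * a < m].
Proof.
move=> a_ge0 m_gt0 T_ge0; pose B := 1 + 2 * T + 8 * a / m.
have am_ge0 : 0 <= 8 * a / m by rewrite divr_ge0 ?mulr_ge0// ltW.
have B_gt0 : 0 < B by rewrite /B; lra.
have Bi_gt0 : 0 < B^-1 by rewrite invr_gt0.
have B_inv : B^-1 ^+ 2 <= B^-1.
  by rewrite expr2 ler_piMl ?(ltW Bi_gt0)// invf_le1// /B; lra.
exists B^-1; split => //.
  by rewrite mulrC ler_pdivrMr// /B; lra.
apply: (@le_lt_trans _ _ (8 * a * B^-1)).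
  by rewrite mulrAC ler_wpM2l// mulr_ge0.
by rewrite ltr_pdivrMr// -ltr_pdivrMl// mulrC /B; lra.
Qed.

Theorem theorem3p1 (R : realType) (r : nat) (E : holomorphic_bundle R r)
    (h : hermitian_metric E) (D : compatible_connection h)
    (kappa0 eps0 : R) (kappa0_gt0 : 0 < kappa0) (eps0_gt0 : 0 < eps0)
    (dbar_bound : forall eps : R, 0 < eps -> eps < eps0 ->
      forall s : section E, smooth_section s -> compactly_supported s ->
        (kappa0%:E * weighted_integral h s (fun z => expR (- eps * modulus z))
         <= weighted_integral h (dbar D s)
              (fun z => expR (- eps * modulus z)))%E)
    (eps : R) (eps_gt0 : 0 < eps) (eps_lt : eps < eps0 / 4) :
  ~ exists s : section E,
      [/\ holomorphic_section D s,
          in_L2 h (fun z => expR (- 4 * eps * modulus z)) s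
        & exists z, s z <> 0].
Proof.
move=> [s [hs [_ sL2] [z0 sz0]]].
pose phi z : R := expR (- (4 * eps) * modulus z).
have phiE : (fun z => expR (- 4 * eps * modulus z)) = phi.
  by apply/funext => z; rewrite /phi mulNr.
rewrite {}phiE in sL2.
have phi_gt0 z : 0 < phi z by exact: expR_gt0.
have phi_ge0 z : 0 <= phi z by exact: ltW.
have phi_cont : continuous phi.
  move=> z; apply: (@continuous_comp _ _ _ (fun z => - (4 * eps) * modulus z)).
    by apply: cvgM; [exact: cvg_cst|exact: modulus_continuous].
  exact: continuous_expR.
have I_ge0 : (0 <= weighted_integral h s phi)%E.
  by apply: integral_ge0 => z _; rewrite lee_fin mulr_ge0 ?sqnorm_ge0.
have I_fin : weighted_integral h s phi \is a fin_num.
  by rewrite -sqrte_fin_num// ge0_fin_numE ?sqrte_ge0.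
pose a := fine (weighted_integral h s phi).
have a_ge0 : 0 <= a by exact: fine_ge0.
(* On a small box the density stays above half its value at z0. *)
pose c := sqnorm h s z0 * phi z0 / 2.
have c_gt0 : 0 < c by rewrite divr_gt0// mulr_gt0// sqnorm_gt0.
have F_cont : {for z0, continuous (fun z => sqnorm h s z * phi z)}.
  by apply: cvgM; [exact: sqnorm_continuous hs.1 z0|exact: phi_cont].
have /nbhs_ballP[d /= d_gt0 Bc] :
    \forall z \near z0, c <= sqnorm h s z * phi z.
  apply: (@cvgr_ge _ _ _ _ _ _ F_cont).
  by rewrite /c ltr_pdivrMr// ltr_pMr ?mulr_gt0 ?sqnorm_gt0// ltr1n.
pose T := `|z0.1| + `|z0.2| + d.
have T_ge0 : 0 <= T by rewrite !addr_ge0// ltW.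
have BT z : ball z0 d z -> `|z.1| <= T /\ `|z.2| <= T.
  have near_le (x y : R) : ball x d y -> `|y| <= `|x| + d.
    move=> /ltW xy; rewrite -[y](subKr x) (le_trans (ler_normB _ _))//.
    by rewrite lerD2l.
  move=> [/near_le B1 /near_le B2]; split.
    by rewrite (le_trans B1)// lerD2r lerDl.
  by rewrite (le_trans B2)// lerD2r lerDr.
pose m := kappa0 * (expR (- 16) * c * (d *+ 2) ^+ 2).
have m_gt0 : 0 < m.
  have d2_gt0 : 0 < d *+ 2 by rewrite mulr2n addr_gt0.
  apply: mulr_gt0 => //; apply: mulr_gt0; last exact: exprn_gt0.
  by apply: mulr_gt0 => //; exact: expR_gt0.
(* The hypothesis applied to the cutoff section, with the weight phi. *)
have key e : 0 < e -> e * T <= 2^-1 -> m <= 8 * e ^+ 2 * a.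
  move=> e0 eT; rewrite -lee_fin.
  apply: (@le_trans _ _ (kappa0%:E *
      weighted_integral h (scale_section (cutoff e) s) phi)%E).
    rewrite /m EFinM lee_pmul2l// ?lte_fin//.
    exact: (weighted_integral_cutoff_ge hs phi_cont phi_ge0
      (ltW e0) eT d_gt0 (ltW c_gt0) BT Bc).
  rewrite [(8 * e ^+ 2 * a)%:E]EFinM fineK//.
  apply: le_trans
    (weighted_integral_dbar_cutoff_le hs phi_cont phi_ge0 (ltW e0)).
  apply: dbar_bound.
  - by rewrite mulr_gt0.
  - by rewrite mulrC -ltr_pdivlMr.
  - exact: smooth_scale_section (Ck_cutoff e) hs.1.
  - exact: compact_scale_cutoff.
have [e [e_gt0 eT]] := exists_small_scale a_ge0 m_gt0 T_ge0.
by rewrite ltNge key.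
Qed.
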